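(* Let $X$ be a real separable Banach space and let $p \geq 1$ be a real number. If $X$ admits an equivalent norm that is $p$-AUS, then $\Theta_X(n) \gtrsim n^{-1/p}$; that is, there is a constant $c>0$ such that $\Theta_X(n) \geq c\, n^{-1/p}$ for all $n \in \mathbb{N}$.
   Context: $B_X$ is the closed unit ball of $X$ (with its original norm). For $A \subset X$, the essential inradius $\varrho(A) \in [0,\infty]$ is $$\varrho(A) = \sup\{ r>0 : \exists x \in A,\ \exists Y \subset X \text{ closed subspace with } \dim(X/Y)<\infty,\ x + r B_Y \subset A\},$$ where $B_Y = B_X \cap Y$ (and $\sup \emptyset = 0$). Let $\mathcal{C}(X)$ be the family of bounded closed convex subsets of $X$. The covering index is $$\Theta_X(n) = \inf\Big\{ \max_{1\le k\le n} \varrho(A_k) : (A_k)_{k=1}^n \subset \mathcal{C}(X),\ \bigcup_{k=1}^n A_k = B_X \Big\}, \qquad n \in \mathbb{N}.$$ The modulus of asymptotic uniform smoothness of a Banach space $X$ is, for $\varepsilon>0$, $$\overline{\rho}_X(\varepsilon) = \sup_{\|x\|=1}\ \inf_{\dim(X/Y)<\infty}\ \sup_{y \in Y,\ \|y\|\le \varepsilon} (\|x+y\|-1),$$ where $Y$ runs over closed finite-codimensional subspaces. The norm of $X$ is $p$-AUS if there is $C>0$ with $\overline{\rho}_X(\varepsilon) \leq C \varepsilon^p$ for all $\varepsilon > 0$. For $p=1$ the same formula is used as the definition of ''$1$-AUS''. *)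

(* Defs.v *)
From HB Require Import structures.
From mathcomp Require Import all_boot all_order all_algebra.
From mathcomp Require Import all_classical all_reals all_analysis.

Set Implicit Arguments.
Unset Strict Implicit.
Unset Printing Implicit Defensive.

Import Order.TTheory GRing.Theory Num.Theory.
Import numFieldNormedType.Exports.

Local Open Scope classical_set_scope.
Local Open Scope ring_scope.

Definition separable (T : topologicalType) : Prop :=
  exists D : set T, countable D /\ dense D.

(* dim (X / Y) < oo: finitely many classes modulo Y span the quotient. *)
Definition finite_codim (R : realType) (X : lmodType R) (Y : set X) : Prop :=
  exists (m : nat) (e : 'I_m -> X), forall x : X,
    exists a : 'I_m -> R, Y (x - \sum_(i < m) a i *: e i).

Definition closed_fincodim_subspace (R : realType) (X : normedModType R)
    (Y : set X) : Prop :=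
  [/\ GRing.submod_closed (mem Y), closed Y & finite_codim Y].

Definition unit_ball (R : realType) (X : normedModType R) : set X :=
  [set x | `|x| <= 1].

Arguments unit_ball {R} X.

(* The outer maximum with 0 implements the convention sup set0 = 0
   (ereal_sup set0 is -oo). *)
Definition essential_inradius (R : realType) (X : normedModType R)
    (A : set X) : \bar R :=
  maxe 0%E (ereal_sup [set r%:E | r in [set r : R | 0 < r /\
    exists2 x : X, A x & exists2 Y : set X, closed_fincodim_subspace Y &
      [set x + r *: y | y in unit_ball X `&` Y] `<=` A]]).

Definition bounded_closed_convex (R : realType) (X : normedModType R)
    (A : set X) : Prop :=
  [/\ bounded_set A, closed A & @convex_set R X A].

(* For n > 0 the maximum is over a nonempty family, so that its default
   value -oo plays no role. *)
Definition covering_index (R : realType) (X : normedModType R) (n : nat) :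
    \bar R :=
  ereal_inf [set \big[maxe/-oo%E]_(k < n) essential_inradius (A k) |
    A in [set A : 'I_n -> set X |
      (forall k, bounded_closed_convex (A k)) /\
      \bigcup_(k in [set: 'I_n]) A k = unit_ball X]].

Definition is_norm (R : realType) (X : lmodType R) (N : X -> R) : Prop :=
  [/\ forall x y, N (x + y) <= N x + N y,
      forall (a : R) x, N (a *: x) = `|a| * N x &
      forall x, N x = 0 -> x = 0].

Definition equivalent_norm (R : realType) (X : normedModType R)
    (N : X -> R) : Prop :=
  is_norm N /\ exists a b : R,
    [/\ 0 < a, 0 < b & forall x, a * `|x| <= N x <= b * `|x|].

(* The modulus of asymptotic uniform smoothness of (X, N). Closedness of the
   subspaces refers to the topology of X, which is also that of N whenever N
   is an equivalent norm. *)
Definition aus_modulus (R : realType) (X : normedModType R) (N : X -> R)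
    (eps : R) : \bar R :=
  ereal_sup [set ereal_inf [set ereal_sup [set (N (x + y) - 1)%:E |
        y in [set y : X | Y y /\ N y <= eps]] |
      Y in [set Y : set X | closed_fincodim_subspace Y]] |
    x in [set x : X | N x = 1]].

Definition aus_norm (R : realType) (X : normedModType R) (p : R)
    (N : X -> R) : Prop :=
  exists2 C : R, 0 < C &
    forall eps : R, 0 < eps -> (aus_modulus N eps <= (C * eps `^ p)%:E)%E.

(* Main.v *)
Require Import Defs.
From HB Require Import structures.
From mathcomp Require Import all_boot all_order all_algebra.
From mathcomp Require Import all_classical all_reals all_analysis.
From mathcomp Require Import ring lra.

Import Order.TTheory GRing.Theory Num.Theory.
Import numFieldNormedType.Exports.

Local Open Scope classical_set_scope.
Local Open Scope ring_scope.

(** Let [N] be a [p]-AUS norm with [a |x| <= N x <= b |x|], and let the ball be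
    the union of closed convex sets [A_1, ..., A_n] of essential inradius less
    than [r]. Start at [x = 0] and repeat the following move. The point [x] lies
    in some [A_k]. As the inradius of [A_k] is less than [r], every closed
    finite-codimensional subspace contains a [y] with [|y| <= r] such that
    [x + y] is not in [A_k] ([leave_small_inradius]). A continuous linear
    functional [f] separates [x + y] from [A_k] ([separate_point]); if all later
    moves stay in the kernel of [f], then [A_k] is never entered again. This
    constraint only replaces the subspace by another one of finite codimension
    ([closed_fincodim_setI_ker]), so each move removes a set for good, and at
    most [n] moves produce a point outside all the [A_k] ([escape_all]).

    Asymptotic uniform smoothness makes the moves cheap: if [y] is moreover
    taken in a subspace depending on [x], then
    [N (x + y) <= N x * (1 + 2 C eps^p)] as soon as [N y <= eps * N x]
    ([aus_step]). With [h = a / 2], a move from [N x <= h] leads to at most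
    [h + b r], and a move from [h < N x <= a] adds at most
    [2 a C (b r / h)^p]. For [r = c n^(-1/p)] the latter is at most
    [2 a C (b c / h) / n], so [n] moves add a total of order [c], and for a
    small [c] the final point still satisfies [N x <= a]. It is then a point of
    the unit ball covered by no [A_k], a contradiction.

    The separating functional comes from the Mazur-Orlicz theorem: if [q] is
    sublinear and [q >= d] on a convex set [A], there is a linear [f <= q] with
    [f >= d] on [A]. It is proved by lowering [q] until it forces [f >= d] on
    [A], then taking a minimal sublinear function below; minimality makes it
    linear, by the same lowering applied to one-point sets. *)

(** * Sublinear functions and the Mazur-Orlicz theorem *)

(** Homogeneity is stated as an inequality, the only part that has to be checked
    on examples; applied to [c] and [c^-1] it gives equality. *)
Definition sublinear {R : realType} {V : lmodType R} (q : V -> R) : Prop :=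
  (forall x y, q (x + y) <= q x + q y) /\
  (forall (c : R) x, 0 < c -> q (c *: x) <= c * q x).

Section Sublinear.
Context {R : realType} {V : lmodType R}.
Implicit Types (q : V -> R) (A : set V).

Lemma sublinear0 q : sublinear q -> q 0 = 0.
Proof.
move=> [_ qZ].
have := qZ 2 0 ltac:(lra); have := qZ 2^-1 0 ltac:(lra).
by rewrite !scaler0; lra.
Qed.

Lemma sublinearZ q (c : R) x : sublinear q -> 0 <= c -> q (c *: x) = c * q x.
Proof.
move=> qS; rewrite le_eqVlt => /predU1P[<-|c0].
  by rewrite scale0r sublinear0// mul0r.
apply/eqP; rewrite eq_le qS.2//= -ler_pdivlMl//.
by rewrite -{1}(scalerK (lt0r_neq0 c0) x) qS.2// invr_gt0.
Qed.

Lemma sublinear_opp_ge q x : sublinear q -> - q (- x) <= q x.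
Proof. by move=> qS; have := qS.1 x (- x); rewrite subrr sublinear0//; lra. Qed.

(** An infimum of sublinear functions need not be subadditive: the function
    used at [v + w] must be chosen from those used at [v] and at [w]. This is
    possible in a chain and in a [lowering_family]. *)
Lemma inf_sublinear (G : set (V -> R)) : G !=set0 ->
  (forall v, has_lbound [set g v | g in G]) ->
  (forall g1 g2 v w, G g1 -> G g2 ->
    exists2 g, G g & g (v + w) <= g1 v + g2 w) ->
  (forall g (c : R) v, G g -> 0 < c -> exists2 g', G g' & g' (c *: v) <= c * g v) ->
  sublinear (fun v => inf [set g v | g in G]).
Proof.
move=> G0 Glb GD GZ.
have Gv0 v : [set g v | g in G] !=set0 by case: G0 => g Gg; exists (g v), g.
have inf_le v g : G g -> inf [set g v | g in G] <= g v.
  by move=> Gg; apply: ge_inf => //; exists g.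
split=> [v w|c v c0].
  rewrite -lerBlDr; apply: lb_le_inf => // _ [g1 Gg1 <-].
  rewrite lerBlDl -lerBlDr; apply: lb_le_inf => // _ [g2 Gg2 <-].
  rewrite lerBlDr [leRHS]addrC; have [g Gg] := GD _ _ v w Gg1 Gg2.
  by move=> gle; apply: le_trans gle; exact: inf_le.
rewrite -ler_pdivrMl//; apply: lb_le_inf => // _ [g Gg <-].
rewrite ler_pdivrMl//; have [g' Gg'] := GZ _ _ v Gg c0.
by move=> gle; apply: le_trans gle; exact: inf_le.
Qed.

Lemma convex_set_scale A (a b : V) (s t : R) : @convex_set R V A ->
  A a -> A b -> 0 <= s -> 0 <= t ->
  exists2 c, A c & s *: a + t *: b = (s + t) *: c.
Proof.
move=> cA Aa Ab s0 t0; have [st0|st_neq0] := eqVneq (s + t) 0.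
  have s_eq0 : s = 0 by lra.
  have t_eq0 : t = 0 by lra.
  by exists a => //; rewrite s_eq0 t_eq0 addr0 !scale0r addr0.
have st_gt0 : 0 < s + t by rewrite lt_neqAle eq_sym st_neq0 addr_ge0.
have st_l : 0 <= s / (s + t) by rewrite divr_ge0// ltW.
have st_r : s / (s + t) <= 1 by rewrite ler_pdivrMr// mul1r lerDl.
exists (s / (s + t) *: a + t / (s + t) *: b); last first.
  by rewrite scalerDr !scalerA !(mulrC (s + t)) !divfK.
have := cA a b (Itv01 st_l st_r); rewrite !inE => /(_ Aa Ab).
rewrite [X in A X -> _]/(_ *: _ + _ *: _)/= /unstable.onem.
by have -> : 1 - s / (s + t) = t / (s + t) by field.
Qed.

Definition lowering_family q A (d : R) : set (V -> R) :=
  [set g | exists t a, [/\ 0 <= t, A a & g = fun w => q (w + t *: a) - t * d]].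

(** If [q >= d] on the convex set [A], this is the largest sublinear function
    below [q] whose value at [- a] is at most [- d] for every [a] in [A]; a linear [f] below it satisfies [f >= d]
    on [A]. *)
Definition lowering q A (d : R) (v : V) : R :=
  inf [set g v | g in lowering_family q A d].

Section Lowering.
Variables (q : V -> R) (A : set V) (d : R).
Hypotheses (qS : sublinear q) (cA : @convex_set R V A) (A0 : A !=set0)
  (qA : forall a, A a -> d <= q a).

Let family_lb v : lbound [set g v | g in lowering_family q A d] (- q (- v)).
Proof.
move=> _ [_ [t [a [t0 Aa ->]]] <-].
have := qS.1 (- v) (v + t *: a); rewrite addKr (sublinearZ _ _ _ qS t0).
by have := ler_wpM2l t0 (qA _ Aa); lra.
Qed.

(** The two parameters of a sum merge: [t *: a + s *: b] is
    [(t + s) *: c] with [c] in the convex set [A]. *)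
Lemma sublinear_lowering : sublinear (lowering q A d).
Proof.
apply: inf_sublinear.
- by case: A0 => a Aa; eexists; exists 0, a.
- by move=> v; exists (- q (- v)); exact: family_lb.
- move=> _ _ v w [t [a [t0 Aa ->]]] [s [b [s0 Ab ->]]].
  have [c Ac tsE] := convex_set_scale _ _ _ _ _ cA Aa Ab t0 s0.
  exists (fun w => q (w + (t + s) *: c) - (t + s) * d).
    by exists (t + s), c; split=> //; rewrite addr_ge0.
  rewrite -tsE addrACA.
  by have := qS.1 (v + t *: a) (w + s *: b); lra.
- move=> _ c v [t [a [t0 Aa ->]]] c0.
  exists (fun w => q (w + (c * t) *: a) - (c * t) * d).
    by exists (c * t), a; split=> //; rewrite mulr_ge0// ltW.
  rewrite -scalerA -scalerDr mulrBr mulrA.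
  by have := qS.2 _ (v + t *: a) c0; lra.
Qed.

Lemma lowering_le v : lowering q A d v <= q v.
Proof.
case: A0 => a Aa; apply: ge_inf; first by exists (- q (- v)); exact: family_lb.
exists (fun w => q (w + 0 *: a) - 0 * d); first by exists 0, a.
by rewrite scale0r mul0r addr0 subr0.
Qed.

Lemma lowering_opp_le a : A a -> lowering q A d (- a) <= - d.
Proof.
move=> Aa; apply: ge_inf; first by exists (- q (- - a)); exact: family_lb.
exists (fun w => q (w + 1 *: a) - 1 * d); first by exists 1, a; split.
by rewrite scale1r mul1r addNr sublinear0// sub0r.
Qed.

End Lowering.

(** Zorn's lemma applies because sublinear functions below [q] are bounded below
    at [v] by [- q (- v)], so that chains have pointwise infima. *)
Lemma minimal_sublinear q : sublinear q ->
  exists m : V -> R, [/\ sublinear m, forall v, m v <= q v &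
    forall m', sublinear m' -> (forall v, m' v <= m v) -> forall v, m v <= m' v].
Proof.
move=> qS; pose T := {m : V -> R | sublinear m /\ forall v, m v <= q v}.
pose below (m1 m2 : T) : bool := `[< forall v, sval m2 v <= sval m1 v >].
have t0 : T by exists q.
have [||C Ctot|[m [mS mq]] m_max] := @ZL_preorder T t0 below.
- by move=> m; apply/asboolP.
- move=> m2 m1 m3 /asboolP m12 /asboolP m23; apply/asboolP => v.
  exact: le_trans (m23 v) (m12 v).
- have [[c0 Cc0]|/nonemptyPn ->] := pselect (C !=set0); last by exists t0.
  pose G := [set sval c | c in C].
  have G_lb v : lbound [set g v | g in G] (- q (- v)).
    move=> _ [_ [[c [cS cq]] _ <-] <-] /=.
    by apply: le_trans (sublinear_opp_ge _ v cS); rewrite lerN2.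
  have G_inf v c : C c -> inf [set g v | g in G] <= sval c v.
    move=> Cc; apply: ge_inf; first by exists (- q (- v)).
    by exists (sval c) => //; exists c.
  have infS : sublinear (fun v => inf [set g v | g in G]).
    apply: inf_sublinear.
    + by exists (sval c0), c0.
    + by move=> v; exists (- q (- v)).
    + move=> _ _ v w [c1 Cc1 <-] [c2 Cc2 <-].
      have [/asboolP c21|/asboolP c12] := Ctot _ _ Cc1 Cc2.
      * exists (sval c2); first by exists c2.
        by apply: le_trans ((svalP c2).1.1 v w) _; rewrite lerD2r.
      * exists (sval c1); first by exists c1.
        by apply: le_trans ((svalP c1).1.1 v w) _; rewrite lerD2l.
    + move=> _ c v [c1 Cc1 <-] c_gt0; exists (sval c1); first by exists c1.
      exact: (svalP c1).1.2.
  have inf_le_q v : inf [set g v | g in G] <= q v.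
    exact: le_trans (G_inf v c0 Cc0) ((svalP c0).2 v).
  exists (exist _ _ (conj infS inf_le_q) : T) => c Cc; apply/asboolP => v /=.
  exact: G_inf.
- exists m; split=> // m' m'S m'm.
  have m'q v : m' v <= q v by exact: le_trans (m'm v) (mq v).
  by apply/asboolP; apply: (m_max (exist _ _ (conj m'S m'q) : T)); exact/asboolP.
Qed.

(** A minimal sublinear [m] below the lowering of [q] is linear: lowering [m]
    on [[set y]] at level [m y] changes nothing by minimality, whence
    [m (- y) <= - m y]. *)
Lemma mazur_orlicz q A (d : R) : sublinear q -> @convex_set R V A -> A !=set0 ->
  (forall a, A a -> d <= q a) ->
  exists f : {linear V -> R^o}, (forall v, f v <= q v) /\ forall a, A a -> d <= f a.
Proof.
move=> qS cA A0 qA.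
have [m [mS m_low m_min]] :=
  minimal_sublinear _ (sublinear_lowering _ _ _ qS cA A0 qA).
have mN y : m (- y) = - m y.
  have c1 : @convex_set R V [set y].
    by move=> u v l; rewrite !inE /= => -> ->; rewrite convmm.
  have y0 : [set y] !=set0 by exists y.
  have my a : [set y] a -> m y <= m a by move=> ->.
  apply/eqP; rewrite eq_le -[X in _ && X]lerNl sublinear_opp_ge// andbT.
  apply: le_trans (lowering_opp_le _ _ _ mS my _ (erefl y)).
  apply: m_min; first exact: sublinear_lowering.
  exact: lowering_le.
have mD x y : m (x + y) = m x + m y.
  apply/eqP; rewrite eq_le mS.1/= -lerN2 -mN !opprD.
  by rewrite -!mN mS.1.
have mZ (c : R) x : m (c *: x) = c * m x.
  have [c0|c0] := leP 0 c; first exact: sublinearZ.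
  rewrite -[c]opprK scaleNr mN mulNr -[RHS]/(- _); congr (- _).
  by rewrite sublinearZ// oppr_ge0 ltW.
have m_lin : linear (m : V -> R^o) by move=> c x y; rewrite mD mZ.
exists (HB.pack_for {linear V -> R^o} (m : V -> R^o)
  (GRing.isLinear.Build _ _ _ _ (m : V -> R^o) m_lin)); split=> /= [v|a Aa].
  by apply: le_trans (m_low v) _; exact: lowering_le.
rewrite -lerN2 -mN; apply: le_trans (m_low _) _; exact: lowering_opp_le.
Qed.

End Sublinear.

(** * Separation by kernels of finite codimension *)

Section Separation.
Context {R : realType} {X : normedModType R}.
Implicit Types (A Y W : set X) (f : {linear X -> R^o}).

Lemma norm_sublinear : sublinear (fun x : X => `|x|).
Proof. by split=> [x y|c x c0]; [exact: ler_normD|rewrite normrZ gtr0_norm]. Qed.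

Lemma convex_set_translate A z : @convex_set R X A ->
  @convex_set R X [set v | A (v + z)].
Proof.
move=> cA x y l; rewrite !inE/= => Ax Ay.
have := cA (x + z) (y + z) l; rewrite !inE => /(_ Ax Ay).
rewrite [X in A X -> _](_ : _ = (conv l (x : convex_lmodType X) y : X) + z)//.
change (l%:num *: (x + z) + unstable.onem l%:num *: (y + z) =
  (l%:num *: x + unstable.onem l%:num *: y) + z).
by rewrite !scalerDr addrACA -scalerDl unstable.add_onemK scale1r.
Qed.

(** A ball of radius [d > 0] around [z] misses [A], so the norm is at least [d]
    on the convex set [A - z], and the Mazur-Orlicz theorem applies to it. *)
Lemma separate_point A z : closed A -> @convex_set R X A -> A !=set0 -> ~ A z ->
  exists f, (forall x, f x <= `|x|) /\
    exists2 d : R, 0 < d & forall a, A a -> d <= f (a - z).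
Proof.
move=> clA cA [a0 Aa0] nAz.
have /nbhs_ballP[d /= d0 dA] : nbhs z (~` A).
  by apply: open_nbhs_nbhs; split=> //; exact: closed_openC.
have [|v /= Avz|f [f_le f_ge]] := @mazur_orlicz _ _ _ _ d norm_sublinear
    (convex_set_translate A z cA).
- by exists (a0 - z); rewrite /= subrK.
- rewrite leNgt; apply/negP => vd; apply: (dA _ _ Avz).
  by rewrite -ball_normE /= opprD addrCA subrr addr0 normrN.
- exists f; split=> //; exists d => // a Aa.
  by apply: f_ge; rewrite /= subrK.
Qed.

Lemma closed_ker f : (forall x, f x <= `|x|) -> closed [set x | f x = 0].
Proof.
move=> f_le; apply: (@preimage_closed _ _ f [set x | x = 0]); last exact: closed_eq.
move=> x _; move: x; apply/linear_bounded_continuous/linear_boundedP.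
near=> r => x; apply: (@le_trans _ _ `|x|).
  by rewrite ler_norml f_le andbT lerNl -linearN -[leRHS]normrN f_le.
by rewrite ler_peMl//; near: r; exact: nbhs_pinfty_ge.
Unshelve. all: by end_near. Qed.

Lemma submodP Y : GRing.submod_closed (mem Y) <->
  Y 0 /\ forall (a : R) x y, Y x -> Y y -> Y (a *: x + y).
Proof.
split=> [[Y0 YD]|[Y0 YD]]; split.
- by move: Y0; rewrite !inE.
- by move=> a x y Yx Yy; have := YD a x y; rewrite !inE; exact.
- by rewrite !inE.
- by move=> a x y; rewrite !inE; exact: YD.
Qed.

Lemma closed_fincodim_setT : closed_fincodim_subspace (@setT X).
Proof.
split; first exact/submodP; first exact: closedT.
by exists 0%N, (fun=> 0) => x; exists (fun=> 0).
Qed.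

(** If [f] does not vanish on [Y], one vector [y] of [Y] with [f y != 0] added
    to a spanning family modulo [Y] makes it spanning modulo the kernel. *)
Lemma closed_fincodim_setI_ker Y f : (forall x, f x <= `|x|) ->
  closed_fincodim_subspace Y ->
  closed_fincodim_subspace (Y `&` [set x | f x = 0]).
Proof.
move=> f_le [/submodP[Y0 YD] clY [m [e Ye]]]; split.
- apply/submodP; split; first by split=> //=; rewrite linear0.
  move=> a x y [Yx /= fx] [Yy /= fy]; split; first exact: YD.
  by rewrite linearP fx fy scaler0 addr0.
- by apply: closedI => //; exact: closed_ker.
- have [f0|] := pselect (forall y, Y y -> f y = 0).
    by exists m, e => x; have [a Ya] := Ye x; exists a; split=> //; exact: f0.
  move=> /existsNP[y /not_implyP[Yy fy0]].
  have {}fy0 : f y != 0 by apply/eqP.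
  (* [y] is the last vector of the new family, [e] gives the first [m]. *)
  exists m.+1, (fun i => oapp e y (unlift ord_max i)) => x.
  have [a Ya] := Ye x; set z := x - _ in Ya.
  exists (fun i => oapp a (f z / f y) (unlift ord_max i)).
  rewrite big_ord_recr/= unlift_none/=.
  under eq_bigr => i _.
    rewrite (_ : widen_ord _ i = lift ord_max i); last first.
      by apply: val_inj; exact: esym (lift_max i).
    rewrite liftK/=; over.
  rewrite opprD addrA -/z; split.
    by rewrite addrC -scaleNr; exact: YD.
  by rewrite /= linearB linearZ/= [X in _ - X]divfK// subrr.
Qed.

End Separation.

(** * Escaping from convex sets of small essential inradius *)

Section Escape.
Context {R : realType} {X : normedModType R}.
Implicit Types (A Y W : set X) (N : X -> R).

Lemma leave_small_inradius A Y x (r : R) : closed_fincodim_subspace Y ->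
  0 < r -> A x -> (essential_inradius A < r%:E)%E ->
  exists y, [/\ Y y, `|y| <= r & ~ A (x + y)].
Proof.
move=> Yc r0 Ax; apply: contraPP => nex; apply/negP; rewrite -leNgt.
rewrite /essential_inradius le_max; apply/orP; right.
apply: ereal_sup_ubound; exists r => //; split=> //; exists x => //; exists Y => //.
move=> _ [y [/= y1 Yy] <-]; apply: contrapT => nA; apply: nex.
exists (r *: y); split=> //.
  have [/submodP[Y0 YD] _ _] := Yc.
  by rewrite -[_ *: _]addr0; exact: YD.
by rewrite normrZ gtr0_norm// -[leRHS]mulr1 ler_pM2l.
Qed.

(** This stability under intersection holds for the whole space and passes from
    [W] to its intersection with the kernel of a continuous functional, which
    avoids intersecting two arbitrary finite-codimensional subspaces. *)
Definition trace_fincodim W : Prop :=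
  forall Y, closed_fincodim_subspace Y -> closed_fincodim_subspace (Y `&` W).

(** [W] collects the directions that remain allowed and [S] the sets that are
    left for ever: [x + W] misses [A k] for [k] in [S]. A set containing the
    current point is not in [S], so each move enlarges [S]. The maximum with [s]
    in the cost accounts for moves from points of small [N], whose cost is not
    small but which end below the fixed level [s]. *)
Lemma escape_all N n (A : 'I_n -> set X) (r s D : R) : 0 < r -> 0 <= D ->
  (forall k, bounded_closed_convex (A k)) ->
  (forall k, essential_inradius (A k) < r%:E)%E ->
  N 0 <= s ->
  (forall x, N x <= s + n%:R * D -> exists2 Y, closed_fincodim_subspace Y &
    forall y, Y y -> `|y| <= r -> N (x + y) <= Num.max s (N x + D)) ->
  exists x, N x <= s + n%:R * D /\ forall k, ~ A k x.
Proof.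
move=> r0 D0 AP A_small N0 step; apply: contrapT => nex.
have bound_mono i : (i <= n)%N -> s + i%:R * D <= s + n%:R * D.
  by move=> le_in; rewrite lerD2l ler_wpM2r// ler_nat.
suff [x [W [S [Nx Wc SA Sn]]]] : exists x W (S : {set 'I_n}),
    [/\ N x <= s + n%:R * D, trace_fincodim W,
      forall k, k \in S -> forall w, W w -> ~ A k (x + w) & #|S| = n].
  apply: nex; exists x; split=> // k Akx.
  have [/submodP[[_ W0] _] _ _] := Wc _ closed_fincodim_setT.
  apply: (SA k _ 0 W0); last by rewrite addr0.
  have -> : S = [set: 'I_n]%SET; last by rewrite inE.
  by apply/eqP; rewrite eqEcard finset.subsetT cardsT card_ord Sn /=.
suff H i : (i <= n)%N -> exists x W (S : {set 'I_n}),
    [/\ N x <= s + i%:R * D, trace_fincodim W,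
      forall k, k \in S -> forall w, W w -> ~ A k (x + w) & #|S| = i] by exact: H.
elim: i => [_|i IH lt_in].
  exists 0, setT, finset.set0; split; rewrite ?mul0r ?addr0 ?cards0//.
    by move=> Y Yc; rewrite setIT.
  by move=> k; rewrite inE.
have [x [W [S [Nx Wc SA Si]]]] := IH (ltnW lt_in).
have Nx_le : N x <= s + n%:R * D by apply: le_trans Nx _; exact/bound_mono/ltnW.
have [k Akx] : exists k, A k x.
  by apply: contrapT => nA; apply: nex; exists x; split=> // k ?; apply: nA; exists k.
have [/submodP[[_ W0] WD] _ _] := Wc _ closed_fincodim_setT.
have kS : k \notin S.
  by apply/negP => /SA/(_ 0 W0); rewrite addr0.
have [Y Yc NY] := step x Nx_le.
have [y [[Yy Wy] yr nAxy]] := leave_small_inradius _ _ _ _ (Wc _ Yc) r0 Akx (A_small k).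
have [_ clA cA] := AP k.
have [f [f_le [d d0 fd]]] := separate_point _ _ clA cA (ex_intro _ x Akx) nAxy.
exists (x + y), (W `&` [set v | f v = 0]), (k |: S)%SET; split.
- apply: le_trans (NY _ Yy yr) _; rewrite ge_max.
  rewrite lerDl mulr_ge0//= -natr1 mulrDl mul1r.
  by move: Nx; lra.
- by move=> Z Zc; rewrite setIA; apply: closed_fincodim_setI_ker => //; exact: Wc.
- move=> j; rewrite !inE => /predU1P[->|jS] w [Ww /= fw].
    by move=> /fd; rewrite addrC addKr fw leNgt d0.
  rewrite -addrA; apply: SA => //.
  by have [] := WD 1 y w (conj I Wy) (conj I Ww); rewrite scale1r.
- by rewrite cardsU1 kS Si.
Qed.

(** This is the definition of the modulus at [x / N x], rescaled. The factor [2]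
    is the slack that turns the infimum over subspaces into a single one. *)
Lemma aus_step N (C p eps : R) x : is_norm N -> 0 < C -> 0 < eps ->
  (aus_modulus N eps <= (C * eps `^ p)%:E)%E -> 0 < N x ->
  exists2 Y, closed_fincodim_subspace Y &
    forall y, Y y -> N y <= eps * N x -> N (x + y) <= N x * (1 + 2 * C * eps `^ p).
Proof.
move=> [_ NZ _] C0 e0 aus Nx0.
have ep0 := powR_gt0 p e0.
have normN : `|(N x)^-1| = (N x)^-1 by rewrite gtr0_norm// invr_gt0.
pose u := (N x)^-1 *: x.
have Nu : N u = 1.
  by rewrite NZ normN mulVf// gt_eqF.
have : (aus_modulus N eps < (2 * C * eps `^ p)%:E)%E.
  by apply: le_lt_trans aus _; rewrite lte_fin ltr_pM2r//; lra.
move=> /(le_lt_trans (ereal_sup_ubound (ex_intro2 _ _ u Nu erefl))).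
move=> /ereal_inf_lt[_ [Y Yc <-] supY].
exists Y => // y Yy Ny.
have [/submodP[Y0 YD] _ _] := Yc.
have Yz : Y ((N x)^-1 *: y) by rewrite -[_ *: _]addr0; exact: YD.
have Nz : N ((N x)^-1 *: y) <= eps.
  by rewrite NZ normN ler_pdivrMl// mulrC.
have := le_lt_trans (ereal_sup_ubound (ex_intro2 _ _ _ (conj Yz Nz) erefl)) supY.
rewrite -scalerDr NZ normN lte_fin ltrBlDr => /ltW.
by rewrite ler_pdivrMl// [X in _ * X]addrC.
Qed.

End Escape.

(** * The lower bound for the covering index *)

Theorem theorem3p5 (R : realType) (X : completeNormedModType R) (p : R)
    (X_separable : separable X) (p_ge1 : 1 <= p)
    (X_aus : exists N : X -> R, equivalent_norm N /\ aus_norm p N) :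
  exists2 c : R, 0 < c &
    forall n : nat, (0 < n)%N ->
      ((c * n%:R `^ (- p^-1))%:E <= covering_index X n)%E.
Proof.
have [N [[Nnorm [a [b [a0 b0 Nab]]]] [C C0 aus]]] := X_aus.
have [ND NZ _] := Nnorm.
(* [h] separates the two kinds of moves; [q = b * c] is such that
   [q] and the total [4 * C * q] of the increments are at most [h / 2] each. *)
pose h := a / 2.
pose q := Num.min (h / 2) (h / (8 * C)).
have h0 : 0 < h by rewrite divr_gt0.
have q0 : 0 < q by rewrite lt_min !divr_gt0// mulr_gt0.
have qh : q <= h / 2 by rewrite ge_min lexx.
have qC : 8 * C * q <= h.
  by rewrite mulrC -ler_pdivlMr ?mulr_gt0// ge_min lexx orbT.
have aE : a = 2 * h by rewrite /h; field.
exists (q / b) => [|n n0]; first exact: divr_gt0.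
have n0R : 0 < n%:R :> R by rewrite ltr0n.
pose t := n%:R `^ (- p^-1) : R.
have t0 : 0 < t by exact: powR_gt0.
have p0 : 0 < p by lra.
have t1 : t <= 1.
  rewrite -(@powRr0 _ n%:R); apply: ler_powR; first by rewrite ler1n.
  by rewrite oppr_le0 invr_ge0 ltW.
have tp : t `^ p = n%:R^-1.
  by rewrite -powRrM mulNr mulVf ?gt_eqF// powR_inv1// ltW.
apply/ereal_infP => _ [A [AP Acov] <-]; rewrite leNgt; apply/negP => small.
have r0 : 0 < q / b * t by rewrite mulr_gt0// divr_gt0.
have qh0 : 0 < q / h by exact: divr_gt0.
pose eps := q / h * t.
have eps0 : 0 < eps by exact: mulr_gt0.
(* [p >= 1] and [q <= h] replace [(q / h) ^ p] by [q / h]. *)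
have epsp : eps `^ p <= q / h / n%:R.
  rewrite (powRM _ (ltW qh0) (ltW t0)) tp ler_pM2r ?invr_gt0//.
  by apply: ge1r_powR => //; rewrite qh0/= ler_pdivrMr//; lra.
pose D := 4 * C * q / n%:R.
have D0 : 0 <= D by rewrite divr_ge0 ?mulr_ge0 ?ltW.
have nD : n%:R * D = 4 * C * q by rewrite /D mulrC divfK// gt_eqF.
have N0 : N 0 = 0 by rewrite -(scale0r 0) NZ normr0 mul0r.
have qt : q * t <= q by rewrite ger_pMr.
have Ny_le (y : X) : `|y| <= q / b * t -> N y <= q * t.
  move=> yr; have /andP[_ Ny] := Nab y; apply: le_trans Ny _.
  apply: (@le_trans _ _ (b * (q / b * t))); first by rewrite ler_pM2l.
  by rewrite mulrA mulrCA divff ?gt_eqF// mulr1.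
have [|||x [Nx nAx]] := escape_all N n A (q / b * t) (h + q) D r0 D0 AP.
- move=> k; apply: le_lt_trans small; exact: le_bigmax.
- by rewrite N0 addr_ge0 ?ltW.
- move=> x Nx; have {}Nx : N x <= a by rewrite aE; move: Nx; rewrite nD; lra.
  have [Nxh|hNx] := leP (N x) h.
    exists setT; first exact: closed_fincodim_setT.
    move=> y _ /Ny_le Ny; rewrite le_max; apply/orP; left.
    by apply: le_trans (ND x y) _; lra.
  have Nx0 : 0 < N x by exact: lt_trans hNx.
  have [Y Yc HY] := aus_step N C p eps x Nnorm C0 eps0 (aus _ eps0) Nx0.
  exists Y => // y Yy /Ny_le Ny; rewrite le_max; apply/orP; right.
  apply: (le_trans (HY y Yy _)).
    apply: le_trans Ny _; rewrite /eps mulrAC ler_pM2r// mulrAC.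
    by rewrite ler_pdivlMr// ler_pM2l// ltW.
  rewrite mulrDr mulr1 lerD2l.
  apply: (@le_trans _ _ (a * (2 * C * (q / h / n%:R)))).
    apply: ler_pM => //; [exact: ltW|by rewrite mulr_ge0 ?mulr_ge0 ?powR_ge0 ?ltW|].
    by rewrite ler_pM2l// mulr_gt0.
  rewrite le_eqVlt; apply/orP; left; apply/eqP; rewrite aE /D.
  by field; rewrite !gt_eqF.
- have : unit_ball X x.
    rewrite /unit_ball/= -(@ler_pM2l _ a)// mulr1.
    have /andP[aN _] := Nab x; apply: le_trans aN _.
    by rewrite aE; move: Nx; rewrite nD; lra.
  by rewrite -Acov => -[k _]; exact: nAx.
Qed.
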